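(* Let $c\ge 0$ be an integer. On the triangle graph $C_3$, the number of chip configurations that are debt-reachable from $(c,0,0)$ is equal to $$\frac{3k^2+3k+2}{2}\ \text{ if } c=3k,\qquad \frac{3k^2+5k+2}{2}\ \text{ if } c=3k+1,\qquad \frac{3k^2+7k+4}{2}\ \text{ if } c=3k+2,$$ where $k\ge 0$ is an integer.
   Context: $C_3$ is the cycle graph on vertices $1,2,3$ (every vertex has degree $2$ and is adjacent to the other two). A chip configuration on a graph with vertices $1,\dots,n$ is an $n$-tuple of nonnegative integers $(c_1,\dots,c_n)$, with $c_i$ the number of chips on vertex $i$; a general chip-firing configuration is an arbitrary $n$-tuple of integers. A (general) chip-firing move at vertex $i$, of degree $d_i$, subtracts $d_i$ chips from vertex $i$ and adds one chip to each vertex adjacent to $i$; no condition is imposed on the current number of chips on $i$, so intermediate tuples may have negative entries. A chip configuration $C'$ is debt-reachable from a chip configuration $C$ if some finite (possibly empty) sequence of general chip-firing moves transforms $C$ into $C'$; both $C$ and $C'$ must have nonnegative entries. *)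

(* Defs.v *)
From mathcomp Require Import all_boot all_order all_algebra.

Set Implicit Arguments.
Unset Strict Implicit.
Unset Printing Implicit Defensive.

Import Order.TTheory GRing.Theory Num.Theory.
Local Open Scope ring_scope.

(* A simple graph is given by its adjacency relation, a symmetric and
   irreflexive [rel V] on a finite vertex type. *)
Section ChipFiring.
Variables (V : finType) (adj : rel V).

Definition degree (v : V) : nat := #|[set w | adj v w]|.

Definition gconfig : Type := {ffun V -> int}.

Definition chip_config (C : gconfig) : Prop := forall v, 0 <= C v.

Definition fire (C : gconfig) (v : V) : gconfig :=
  [ffun w => C w - (if w == v then (degree v)%:Z else 0)
                 + (if adj v w then 1 else 0)].

Definition debt_reachable (C C' : gconfig) : Prop :=
  [/\ chip_config C, chip_config C' & exists s : seq V, foldl fire C s = C'].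

End ChipFiring.

Definition C3 : rel 'I_3 := [rel i j | i != j].

Lemma C3_sym : symmetric C3.
Proof. by move=> i j; rewrite /C3 /= eq_sym. Qed.

Lemma C3_irrefl : irreflexive C3.
Proof. by move=> i; rewrite /C3 /= eqxx. Qed.

Lemma degree_C3 (i : 'I_3) : degree C3 i = 2.
Proof.
rewrite /degree (_ : [set w | _] = [set~ i]); first by rewrite cardsC1 card_ord.
by apply/setP => j; rewrite !inE eq_sym.
Qed.

Definition initC3 (c : nat) : gconfig 'I_3 :=
  [ffun i : 'I_3 => [:: c%:Z; 0; 0]`_i].

(* Main.v *)
Require Import Defs.
From mathcomp Require Import all_boot all_order all_algebra.
From mathcomp Require Import boolp classical_sets functions cardinality.
From mathcomp Require Import finmap zify ring.

Set Implicit Arguments.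
Unset Strict Implicit.
Unset Printing Implicit Defensive.

Import Order.TTheory GRing.Theory Num.Theory.
Local Open Scope classical_set_scope.
Local Open Scope ring_scope.

(** On the triangle, firing v is the same as giving one chip to every vertex
    and then taking three from v.  A firing sequence of length n that fires
    w exactly n_w times therefore changes w by n - 3 n_w, which makes both the
    total number of chips and the differences of entries modulo 3 invariant
    ([foldl_fire_C3]).  These invariants are complete: from (c, 0, 0), a
    target (c - x - y, x, y) with x = y modulo 3 has x + 2y = 3t for some t,
    and it is reached by firing the three vertices 2t, y and t times
    ([reachable_initC3P]).

    It remains to count the pairs (x, y) with x + y <= c and 3 | x + 2y.  For a
    fixed sum s = x + y the condition becomes 3 | s + y, so the admissible y
    correspond to the multiples of 3 in the interval [s, 2s].  There are
    k + 1, k, k + 1 of them for s = 3k, 3k + 1, 3k + 2 ([size_layer]), and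
    summing over s <= c gives the three quadratic polynomials
    ([double_layer_sum]). *)

(** * Reachability on the triangle *)

Lemma fire_C3 (C : gconfig 'I_3) (v w : 'I_3) :
  fire C3 C v w = C w + 1 - 3 * (v == w)%:Z.
Proof.
have deg2 : degree C3 v = 2%N by exact: degree_C3.
rewrite ffunE deg2 /C3 /= [w == v]eq_sym; move: (C w) => a.
by case: (v == w) => /=; lia.
Qed.

(** Every move gives one chip to all three vertices and takes three back from
    the fired one, so the order of the moves is irrelevant: only the number of
    times each vertex is fired matters. *)
Lemma foldl_fire_C3 (s : seq 'I_3) (C : gconfig 'I_3) w :
  foldl (fire C3) C s w = C w + (size s)%:Z - 3 * (count_mem w s)%:Z.
Proof.
elim: s C => [|v s IHs] C /=; first by move: (C w) => a; lia.
rewrite IHs fire_C3; move: (C w) (count_mem w s) (v == w) => a n b; lia.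
Qed.

Lemma count_mem_sum_I3 (s : seq 'I_3) :
  (count_mem 0%R s + count_mem 1%R s + count_mem 2%R s)%N = size s.
Proof.
elim: s => //= v s <-.
by case: v => [[|[|[|//]]] ?] /=; lia.
Qed.

Lemma forall_I3 (P : 'I_3 -> Prop) : P 0 -> P 1 -> P 2 -> forall i, P i.
Proof.
move=> P0 P1 P2 [[|[|[|//]]] lti3].
- by rewrite (_ : Ordinal _ = 0) //; apply: val_inj.
- by rewrite (_ : Ordinal _ = 1) //; apply: val_inj.
- by rewrite (_ : Ordinal _ = 2) //; apply: val_inj.
Qed.

(** Two parameters suffice because the total is fixed; [s] counts the chips
    that left the first vertex, so that the configurations can later be
    counted one value of [s] at a time. *)
Definition spread (c s y : nat) : gconfig 'I_3 :=
  [ffun i : 'I_3 => [:: (c - s)%N%:Z; (s - y)%N%:Z; y%:Z]`_i].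

(** Firing counts n0, n1, n2 of sum n lead to x = n - 3 n1 and y = n - 3 n2, so
    x = y modulo 3, which reads 3 | s + y for s = x + y.  Conversely the
    equations are solvable in natural numbers because firing all three
    vertices once changes nothing, so that negative counts can be shifted
    away. *)
Lemma reachable_initC3P c (C : gconfig 'I_3) :
  debt_reachable C3 (initC3 c) C <->
  exists s y : nat,
    [/\ (s <= c)%N, (y <= s)%N, (3 %| s + y)%N & C = spread c s y].
Proof.
split=> [[_ C_ge0 [r def_C]] | [s [y [le_sc le_ys dvd3 ->]]]].
  have C_nat i : exists n : nat, C i = n by exists `|C i|%N; rewrite gez0_abs.
  have [[z Cz] [x Cx] [y Cy]] := And3 (C_nat 0) (C_nat 1) (C_nat 2).
  have cnt := foldl_fire_C3 r (initC3 c); rewrite def_C in cnt.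
  move: (cnt 0) (cnt 1) (cnt 2) (count_mem_sum_I3 r); rewrite !ffunE Cz Cx Cy /=.
  move: (count_mem 0 r) (count_mem 1 r) (count_mem 2 r) => n0 n1 n2 E0 E1 E2 szr.
  exists (x + y)%N, y; split; [lia | lia | lia |].
  by apply/ffunP; apply: forall_I3; rewrite ffunE ?Cz ?Cx ?Cy /=; lia.
split.
- by apply: forall_I3; rewrite ffunE.
- by apply: forall_I3; rewrite ffunE.
have [t def_t] := dvdnP dvd3.
(* With x = s - y and x + 2y = 3t, the total number of moves is 3t + y; vertex 1
   then ends with 3t + y - 3y = x chips and vertex 2 with y. *)
exists (nseq (2 * t) 0 ++ nseq y 1 ++ nseq t 2).
apply/ffunP; apply: forall_I3; rewrite foldl_fire_C3 !ffunE;
  by rewrite !size_cat !size_nseq !count_cat !count_nseq /=; lia.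
Qed.

(** * Counting the reachable configurations *)

Definition layer (s : nat) : seq nat := [seq y <- iota 0 s.+1 | 3 %| s + y]%N.

Definition reachable_list (c : nat) : seq (gconfig 'I_3) :=
  [seq spread c s y | s <- iota 0 c.+1, y <- layer s].

Lemma reachable_list_uniq c : uniq (reachable_list c).
Proof.
apply: allpairs_uniq_dep; first exact: iota_uniq.
  by move=> s _; rewrite filter_uniq ?iota_uniq.
move=> _ _ /allpairsPdep[s [y [s_c y_s ->]]] /allpairsPdep[s' [y' [s'_c y'_s ->]]].
move: s_c s'_c y_s y'_s; rewrite !mem_filter !mem_iota /= => ? ? ? ? /ffunP eqC.
have := And3 (eqC 0) (eqC 1) (eqC 2); rewrite !ffunE /= => -[e0 e1 e2].
by have [-> ->] : s = s' /\ y = y' by split; lia.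
Qed.

Lemma mem_reachable_list c (C : gconfig 'I_3) :
  C \in reachable_list c <-> debt_reachable C3 (initC3 c) C.
Proof.
rewrite reachable_initC3P; split.
  move=> /allpairsPdep[s [y []]]; rewrite mem_filter !mem_iota.
  move=> s_c /andP[dvd3 y_s] ->.
  by exists s, y; split=> //; lia.
move=> [s [y [le_sc le_ys dvd3 ->]]].
by apply/allpairsPdep; exists s, y; rewrite mem_filter !mem_iota dvd3; split.
Qed.

Lemma card_uniq_seq (T : choiceType) (s : seq T) :
  uniq s -> ([set` s] #= `I_(size s))%card.
Proof.
move=> s_uniq; have -> : [set` s] = [set` [fset x in s]%fset].
  by apply/seteqP; split=> x; rewrite /mkset inE.
by apply/card_eq_fsetP; rewrite card_fseq undup_id.
Qed.

Lemma card_reachable c :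
  ([set C | debt_reachable C3 (initC3 c) C] #= `I_(size (reachable_list c)))%card.
Proof.
have -> : [set C | debt_reachable C3 (initC3 c) C] = [set` reachable_list c].
  by apply/seteqP; split=> C /mem_reachable_list.
exact: card_uniq_seq (reachable_list_uniq c).
Qed.

Lemma count_dvdn3_iota a k : count (dvdn 3) (iota a (3 * k)) = k.
Proof.
elim: k a => // k IHk a.
rewrite mulnS iotaD count_cat IHk /=; lia.
Qed.

(** As y runs over [0, s], s + y runs over [s, 2s], so the layer counts the
    multiples of 3 among s + 1 consecutive integers; blocks of three contribute
    one each, and at most three integers are left over. *)
Lemma size_layer k :
  [/\ size (layer (3 * k)) = k.+1,
      size (layer (3 * k + 1)) = k
    & size (layer (3 * k + 2)) = k.+1].
Proof.
have szE s : size (layer s) = count (dvdn 3) (iota s (s + 1)).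
  by rewrite addn1 size_filter -[X in _ = count _ (iota X _)]addn0 iotaDl count_map.
have blocks a j : count (dvdn 3) (iota a (3 * k + j))
                  = (k + count (dvdn 3) (iota (a + 3 * k) j))%N.
  by rewrite iotaD count_cat count_dvdn3_iota.
rewrite !szE -[(_ + 1 + 1)%N]addnA -[(_ + 2 + 1)%N]addnA !blocks.
by split=> /=; lia.
Qed.

Lemma size_reachable_list c :
  size (reachable_list c) = (\sum_(s < c.+1) size (layer s))%N.
Proof.
by rewrite size_allpairs_dep sumnE big_map -(big_mkord xpredT (size \o layer)).
Qed.

(** The sums are doubled so that the polynomials have natural coefficients.
    The induction runs over residue 0 only: three consecutive layers lead from
    3k to 3(k + 1), passing through the other two residues. *)
Lemma double_layer_sum k :
  let N c := (2 * \sum_(s < c.+1) size (layer s))%N in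
  [/\ N (3 * k)%N = (3 * k ^ 2 + 3 * k + 2)%N,
      N (3 * k + 1)%N = (3 * k ^ 2 + 5 * k + 2)%N
    & N (3 * k + 2)%N = (3 * k ^ 2 + 7 * k + 4)%N].
Proof.
move=> N.
have NS c : N c.+1 = (N c + 2 * size (layer c.+1))%N.
  by rewrite /N big_ord_recr /= mulnDr.
have step m : N (3 * m)%N = (3 * m ^ 2 + 3 * m + 2)%N ->
  N (3 * m + 1)%N = (3 * m ^ 2 + 5 * m + 2)%N
  /\ N (3 * m + 2)%N = (3 * m ^ 2 + 7 * m + 4)%N.
  have [_ sz1 sz2] := size_layer m.
  rewrite !addnS !addn0 in sz1 sz2 *; rewrite !NS sz1 sz2 => ->; lia.
suff N3k : N (3 * k)%N = (3 * k ^ 2 + 3 * k + 2)%N by have [] := step k N3k.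
elim: k => [|k IHk].
  by rewrite /N big_ord_recr big_ord0.
have [_ N2] := step k IHk; have [sz0 _ _] := size_layer k.+1.
have e : (3 * k.+1 = (3 * k + 2).+1)%N by lia.
by rewrite e NS N2 -e sz0; lia.
Qed.

Theorem theorem3p1 (c : nat) :
  exists2 N : nat,
    ([set C' : gconfig 'I_3 | debt_reachable C3 (initC3 c) C'] #= `I_N)%card
  & forall k : nat,
    [/\ c = (3 * k)%N ->
          N%:R = (3 * k%:R ^+ 2 + 3 * k%:R + 2) / 2 :> rat,
        c = (3 * k + 1)%N ->
          N%:R = (3 * k%:R ^+ 2 + 5 * k%:R + 2) / 2 :> rat
      & c = (3 * k + 2)%N ->
          N%:R = (3 * k%:R ^+ 2 + 7 * k%:R + 4) / 2 :> rat].
Proof.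
exists (size (reachable_list c)); first exact: card_reachable.
have halve (n m : nat) : (2 * n)%N = m -> n%:R = m%:R / 2 :> rat.
  by move=> <-; rewrite natrM; field.
move=> k; rewrite size_reachable_list.
have [e0 e1 e2] := double_layer_sum k.
by split=> ->; [rewrite (halve _ _ e0) | rewrite (halve _ _ e1)
               | rewrite (halve _ _ e2)]; ring.
Qed.
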